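(* Let $n\ge 1$ be a natural number, and let $0=G_{n+1:0}\le G_{n+1:1}\le\cdots\le G_{n+1:n+1}\le G_{n+1:n+2}=1$ be the ordered spacings of $n$ independent random variables uniformly distributed on $[0,1]$, augmented by the endpoint conventions (as defined in the context). Then for every integer $k$ with $0\le k\le n+1$ and every $x\in(0,1)$ $$\mathsf{P}(G_{n+1:k}\le x<G_{n+1:k+1})=(-1)^k\binom{n+1}{k}\sum_{r=0}^{k}(-1)^r\binom{k}{r}\big(1-(n-r+1)x\big)_+^n.$$
   Context: Let $U_1,\dots,U_n$ be independent random variables, each uniformly distributed on $[0,1]$, and let $U_{n:1}\le\cdots\le U_{n:n}$ be the corresponding order statistics. Put $U_{n:0}:=0$ and $U_{n:n+1}:=1$. The gaps (spacings) are $G_i:=U_{n:i}-U_{n:i-1}$ for integers $i$ with $1\le i\le n+1$. Let $G_{n+1:1}\le\cdots\le G_{n+1:n+1}$ denote the values $G_1,\dots,G_{n+1}$ arranged in nondecreasing order (their order statistics, counted with multiplicity). Also put $G_{n+1:0}:=0$ and $G_{n+1:n+2}:=1$. Notation: $u_+:=\max(0,u)$ for real $u$, and $u_+^n:=(u_+)^n$. *)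

(* Defs.v *)
From mathcomp Require Import all_boot all_order all_algebra.
From mathcomp Require Import all_classical all_reals all_analysis.

Set Implicit Arguments.
Unset Strict Implicit.
Unset Printing Implicit Defensive.

Import Order.TTheory GRing.Theory Num.Theory.
Import numFieldNormedType.Exports.

Local Open Scope classical_set_scope.
Local Open Scope ring_scope.

(* Mutual independence: the product rule over every finite subfamily.  The
   index set is finite, so the subfamilies are the sets J : {set I}. *)
Definition mutually_independent (d d' : measure_display)
    (T : measurableType d) (T' : measurableType d') (R : realType)
    (P : probability T R) (I : finType) (X : I -> {RV P >-> T'}) : Prop :=
  forall (J : {set I}) (A : I -> set T'),
    (forall i, i \in J -> measurable (A i)) ->
    P (\bigcap_(i in [set` J]) (X i @^-1` A i)) =
    (\prod_(i in J) P (X i @^-1` A i))%E.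

(* A law is only meaningful on measurable sets, hence the restriction. *)
Definition uniform01 (d : measure_display) (T : measurableType d)
    (R : realType) (P : probability T R) (X : {RV P >-> R}) : Prop :=
  forall A : set R, measurable A ->
    distribution P X A = uniform_prob (@ltr01 R) A.

(* For 1 <= i <= size s this is the i-th smallest entry of s, counted with
   multiplicity; indices 0 and (size s).+1 give the conventional endpoints
   0 and 1.  Larger indices return the default 0. *)
Definition order_stat (R : realType) (s : seq R) (i : nat) : R :=
  nth 0 (0 :: rcons (sort <=%R s) 1) i.

Definition spacing (R : realType) (s : seq R) (i : nat) : R :=
  order_stat s i - order_stat s i.-1.

Definition spacings (R : realType) (s : seq R) : seq R :=
  [seq spacing s i | i <- iota 1 (size s).+1].

(* G_{n+1:k} for the sample u_0, ..., u_(n-1). *)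
Definition ordered_spacing (R : realType) (n : nat) (u : 'I_n -> R)
    (k : nat) : R :=
  order_stat (spacings [seq u i | i <- enum 'I_n]) k.

(* Main.v *)
Require Import Defs.
From HB Require Import structures.
From mathcomp Require Import all_boot all_order all_algebra all_fingroup.
From mathcomp Require Import zify lra ring.
From mathcomp Require Import all_classical all_reals all_analysis.
From mathcomp Require Import measurable_realfun.

Set Implicit Arguments.
Unset Strict Implicit.
Unset Printing Implicit Defensive.

Import Order.TTheory GRing.Theory Num.Theory.
Import numFieldNormedType.Exports.

Local Open Scope classical_set_scope.
Local Open Scope ring_scope.

(**
The event says that exactly [n.+1 - k] of the [n.+1] spacings exceed [x], so
by the inclusion-exclusion formula for `exactly m' (Waring's formula,
[waring]) everything follows from the probability that all the spacings in a
prescribed set [J] exceed [x]: it is the [n]-th power of the positive part of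
[1 - #|J| * x] ([prob_subset_exceeding]).

That probability is found without integration, by translating.  More
generally let thresholds [delta i >= 0] be given, put
[c := 1 - \sum_i delta i > 0], and require the [i]-th spacing to exceed
[delta i] for every [i].  Split the event according to the permutation [s]
that sorts the sample.  On the piece of [s], subtract from the sample point
of rank [m] the sum of the thresholds of the spacings to its left; this
shrinks the [i]-th spacing by [delta i] and moves the right endpoint from [1]
to [c], so the piece becomes the set of points of the cube ]0, c[^n that [s]
puts in increasing order.  For a fixed [s] the map is a translation, and the
law of the sample, uniform on the unit cube, does not notice translations
between subsets of that cube ([prob_shift], a pi-lambda argument on boxes).
Summing over [s], the event has the same probability as the set of points of
]0, c[^n without ties.  Ties are null ([prob_tie], by a grid), so this is
[c ^+ n] ([prob_gaps_above]).

If [c <= 0] for the thresholds given by [J] and [x], the event is empty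
because the spacings add up to [1].
*)

(** * Inclusion-exclusion for the size of a random set *)

Section waring.
Variable R : comNzRingType.

(** Both sides are the coefficient of ['X^m] in ['X ^+ a], expanded as
[(1 + ('X - 1)) ^+ a] on the left. *)
Lemma sum_sign_binM (a m : nat) :
  \sum_(0 <= j < a.+1) (-1) ^+ (j + m) * 'C(j, m)%:R * 'C(a, j)%:R
    = (a == m)%:R :> R.
Proof.
have expand (j : nat) : (('X - 1 : {poly R}) ^+ j)`_m
    = (-1) ^+ (j + m) * 'C(j, m)%:R.
  have [jm|mj] := ltnP j m.
    by rewrite bin_small// mulr0 nth_default// -polyC1 size_exp_XsubC.
  rewrite addrC -[-1]/(- 1%:P) -polyCN exprDn coef_sum.
  have m_lt : (m < j.+1)%N by [].
  rewrite (bigD1 (Ordinal m_lt))//= big1 => [|i im].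
    rewrite addr0 coefMn -polyC_exp coefCM coefXn eqxx mulr1 -[LHS]mulr_natr.
    congr (_ * _); rewrite -[in RHS](subnK mj) -addnA addnn -mul2n exprD exprM.
    by rewrite sqrrN !expr1n mulr1.
  rewrite coefMn -polyC_exp coefCM coefXn.
  by rewrite -val_eqE /= eq_sym in im; rewrite (negbTE im) mulr0 mul0rn.
have := coefXn R a m; rewrite [in LHS](_ : 'X = 1 + ('X - 1)); last first.
  by rewrite addrC subrK.
rewrite exprDn coef_sum eq_sym => <-; rewrite big_mkord.
by apply: eq_bigr => j _; rewrite expr1n mul1r coefMn expand mulr_natr.
Qed.

Lemma sum_powerset_card (I : finType) (A : {set I}) (f : nat -> R) :
  \sum_(J : {set I} | J \subset A) f #|J|
    = \sum_(0 <= j < #|A|.+1) f j * 'C(#|A|, j)%:R.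
Proof.
rewrite big_mkord.
rewrite (partition_big (fun J : {set I} => inord #|J| : 'I_#|A|.+1) xpredT)//=.
apply: eq_bigr => j _.
have card_inord (J : {set I}) :
    (J \subset A) && (inord #|J| == j) = (J \subset A) && (#|J| == j).
  apply: andb_id2l => /subset_leq_card JA.
  by rewrite -val_eqE/= inordK// ltnS.
rewrite (eq_bigl _ _ card_inord).
rewrite (eq_bigr (fun=> f j)) => [|J /andP[_ /eqP->]//].
by rewrite sumr_const mulr_natr -cards_draws -[RHS]/(f j *+ _) cardsE.
Qed.

(** With [q A] the probability that a random set equals [A], the inner sum is the
probability that it contains [J].  Exchanging the sums, a set [A] receives
the weight computed by [sum_sign_binM], which singles out [#|A| == m]. *)
Lemma waring (I : finType) (q : {set I} -> R) (m : nat) :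
  \sum_(A : {set I} | #|A| == m) q A
  = \sum_(J : {set I}) (-1) ^+ (#|J| + m) * 'C(#|J|, m)%:R
       * \sum_(A : {set I} | J \subset A) q A.
Proof.
under [RHS]eq_bigr do rewrite mulr_sumr big_mkcond/=.
rewrite exchange_big/= big_mkcond; apply: eq_bigr => A _.
rewrite -big_mkcond/= -mulr_suml.
rewrite (sum_powerset_card A (fun j => (-1) ^+ (j + m) * 'C(j, m)%:R)).
by rewrite sum_sign_binM; case: eqP; rewrite ?mul1r ?mul0r.
Qed.

(** The index [r = N - j] counts the elements outside the prescribed set; with
[m = N - k], the terms with [r > k] vanish, and [C(N, j) C(j, m) = C(N, m) C(N - m, j - m)]
pulls the factor [C(N, k)] out. *)
Lemma reverse_waring (g : nat -> R) (N k : nat) : (k <= N)%N ->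
  \sum_(0 <= j < N.+1)
     (-1) ^+ (j + (N - k)) * 'C(j, N - k)%:R * g j * 'C(N, j)%:R
  = (-1) ^+ k * 'C(N, k)%:R *
    \sum_(0 <= r < k.+1) (-1) ^+ r * 'C(k, r)%:R * g (N - r)%N.
Proof.
move=> kN; rewrite big_nat_rev/= add0n.
rewrite (big_cat_nat (n := k.+1))//= ?ltnS//.
rewrite [X in _ + X]big_nat_cond [X in _ + X]big1 => [|r]; last first.
  rewrite andbT => /andP[kr rN].
  by rewrite bin_small ?(mulr0, mul0r)//; lia.
rewrite addr0 mulr_sumr; apply: eq_big_nat => r /andP[_ rk].
rewrite subSS.
have rN : (r <= N)%N by lia.
have sgn : (-1) ^+ (N - r + (N - k)) = (-1) ^+ k * (-1) ^+ r :> R.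
  rewrite -exprD -signr_odd -[RHS]signr_odd; congr ((-1) ^+ _).
  by rewrite !oddD !oddB//; case: (odd N) (odd k) (odd r) => [] [] [].
have bins : ('C(N, N - r) * 'C(N - r, N - k) = 'C(N, k) * 'C(k, r))%N.
  have f0 : (0 < r`! * (k - r)`! * (N - k)`!)%N by rewrite !muln_gt0 !fact_gt0.
  apply/eqP; rewrite -(eqn_pmul2r f0); apply/eqP.
  have /= := bin_fact (leq_subr r N); rewrite subKn// => e1.
  have := @bin_fact (N - r) (N - k) (leq_sub2l N (rk : (r <= k)%N)).
  rewrite (_ : (N - r - (N - k) = k - r)%N); last by lia.
  have := bin_fact kN; have := bin_fact (rk : (r <= k)%N) => e4 e3 e2.
  transitivity N`!; first by rewrite -e1 -e2; ring.
  by rewrite -e3 -e4; ring.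
transitivity ((-1) ^+ k * (-1) ^+ r * g (N - r)%N *
  ('C(N, N - r) * 'C(N - r, N - k))%:R); first by rewrite sgn natrM; ring.
by rewrite bins natrM; ring.
Qed.
End waring.

(** * Increments of finite sequences and sorting permutations *)

Section increments.
Variable R : realType.

(** The right endpoint [c] is a parameter because the translation below turns
spacings of [[0, 1]] into spacings of [[0, c]]. *)
Definition increment (c : R) (s : seq R) (i : nat) : R :=
  nth 0 (0 :: rcons s c) i.+1 - nth 0 (0 :: rcons s c) i.

Lemma increments_gt0P (n : nat) (c : R) (s : seq R) : size s = n -> 0 < c ->
  (forall i : 'I_n.+1, 0 < increment c s i) <->
  sorted <%R s /\ all (fun v => 0 < v < c) s.
Proof.
move=> sn c0; rewrite -[X in _ <-> X]/(_ /\ is_true _).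
have -> : (forall i : 'I_n.+1, 0 < increment c s i) <->
    sorted <%R (0 :: rcons s c).
  split=> [H|/sortedP-/(_ 0) H i].
    apply/(sortedP 0) => i; rewrite /= size_rcons sn ltnS => iS.
    by have := H (Ordinal iS); rewrite subr_gt0.
  by rewrite subr_gt0; apply: H; rewrite /= size_rcons sn ltnS.
rewrite lt_sorted_pairwise pairwise_cons pairwise_rcons all_rcons c0/=.
rewrite -lt_sorted_pairwise; split.
  by move=> /and3P[s0 sc ->]; split=> //; rewrite all_predI s0 sc.
by move=> [-> /=]; rewrite all_predI andbT.
Qed.

Lemma nth_enum_map (n : nat) (f : 'I_n -> R) (i : 'I_n) :
  nth 0 [seq f j | j <- enum 'I_n] i = f i.
Proof. by rewrite (nth_map i) ?size_enum_ord// nth_ord_enum. Qed.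

(** The translation that shrinks all increments at once: the point of rank [m]
moves left by the thresholds of the increments up to its own, the right
endpoint by all of them. *)
Lemma increment_shift (n : nat) (f : 'I_n -> R) (delta : 'I_n.+1 -> R)
    (i : 'I_n.+1) :
  increment (1 - \sum_j delta j)
    [seq f m - \sum_(j : 'I_n.+1 | (j <= m)%N) delta j | m <- enum 'I_n] i
  = increment 1 [seq f m | m <- enum 'I_n] i - delta i.
Proof.
set v := [seq f m - _ | m <- _]; set u := [seq f m | m <- _].
have sv : size v = n by rewrite size_map size_enum_ord.
have su : size u = n by rewrite size_map size_enum_ord.
have pts (l : nat) : (l <= n.+1)%N ->
    nth 0 (0 :: rcons v (1 - \sum_j delta j)) l =
    nth 0 (0 :: rcons u 1) l - \sum_(j : 'I_n.+1 | (j < l)%N) delta j.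
  case: l => [_|l]; first by rewrite /= big_pred0_eq subr0.
  rewrite ltnS leq_eqVlt => /predU1P[->|ln] /=.
    rewrite !nth_rcons sv su ltnn eqxx.
    by congr (_ - _); apply: eq_bigl => j; rewrite ltn_ord.
  rewrite !nth_rcons sv su ln.
  by rewrite (nth_enum_map _ (Ordinal ln)) (nth_enum_map _ (Ordinal ln)).
rewrite /increment !pts//; last exact: ltnW.
rewrite [in X in _ - X - _](bigD1 i)//=.
rewrite (eq_bigl (fun j : 'I_n.+1 => (j < i)%N)) => [|j]; first by ring.
by rewrite ltnS [in RHS]ltn_neqAle andbC.
Qed.

Lemma sort_perm (n : nat) (f : 'I_n -> R) :
  exists s : 'S_n, sort <=%R [seq f i | i <- enum 'I_n]
    = [seq f (s i) | i <- enum 'I_n].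
Proof.
have /tuple_permP[s] : perm_eq (sort <=%R [seq f i | i <- enum 'I_n])
    [tuple f i | i < n] by rewrite perm_sort.
by move=> ->; exists s; apply: eq_map => i; rewrite tnth_mktuple.
Qed.

Lemma sorted_perm_eq (n : nat) (f : 'I_n -> R) (s : 'S_n) :
  sorted <=%R [seq f (s i) | i <- enum 'I_n] ->
  sort <=%R [seq f i | i <- enum 'I_n] = [seq f (s i) | i <- enum 'I_n].
Proof.
move=> fs; apply: (@sorted_eq _ <=%R) => //; first exact: le_trans.
- exact: le_anti.
- exact/sort_sorted/le_total.
rewrite perm_sort; apply/(@tuple_permP _ _ _ [tuple f (s i) | i < n]).
exists (s^-1)%g; apply: eq_map => i.
by rewrite tnth_mktuple permKV.
Qed.

(** A sample without ties is sorted by only one permutation, which makes the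
pieces of the decomposition disjoint. *)
Lemma sorted_perm_inj (n : nat) (f : 'I_n -> R) (s t : 'S_n) :
  sorted <%R [seq f (s i) | i <- enum 'I_n] ->
  sorted <%R [seq f (t i) | i <- enum 'I_n] -> s = t.
Proof.
move=> fs ft; have := sorted_perm_eq (sub_sorted (@ltW _ R) fs).
rewrite (sorted_perm_eq (sub_sorted (@ltW _ R) ft)) => e.
apply/permP => i; apply/eqP.
have := nth_enum_map (fun i => f (s i)) i.
rewrite -e (nth_enum_map (fun i => f (t i))) => fts.
have : injective (fun i => f (s i)).
  apply/injectiveP; rewrite /dinjectiveb/injectiveb.
  by have /lt_sorted_uniq := fs.
move=> /(_ i (s^-1 (t i))%g); rewrite permKV => /(_ (esym fts)).
by move=> /(congr1 s); rewrite permKV => ->.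
Qed.

(** The conventional endpoints [0 <= x] and [1 > x] make the cases [k = 0] and
[k = size s] instances of the general one. *)
Lemma order_stat_count (s : seq R) (k : nat) (x : R) :
  (k <= size s)%N -> 0 <= x < 1 ->
  (order_stat s k <= x < order_stat s k.+1) = (count (<= x) s == k).
Proof.
move=> ks /andP[x0 x1]; rewrite /order_stat.
have ss := sort_sorted (@le_total _ R) s.
rewrite -(count_sort <=%R); set s' := sort _ _ in ss *.
have sz : size s' = size s by rewrite size_sort.
have cs : (count (<= x) s' <= size s)%N by rewrite -sz count_size.
apply/andP/eqP => [[k1 k2]|ck].
  apply/eqP; rewrite eqn_leq; apply/andP; split.
    rewrite leqNgt; apply: contraL k2 => kc; rewrite -leNgt/= nth_rcons sz.
    by rewrite (leq_trans kc cs) nth_count_le.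
  rewrite leqNgt; apply: contraL k1 => kc; rewrite -ltNge.
  case: k {k2} kc ks => // k kc ks; rewrite /= nth_rcons sz ks.
  by rewrite nth_count_gt// sz -ltnS kc.
split.
  case: k ck ks => //= k ck ks; rewrite nth_rcons sz ks.
  by rewrite nth_count_le// ck.
rewrite /= nth_rcons sz; case: ltnP => [ks'|ks'].
  by rewrite nth_count_gt// ck leqnn sz.
by rewrite eqn_leq ks ks'.
Qed.

Lemma count_enum (n : nat) (f : 'I_n -> R) (p : pred R) :
  count p [seq f i | i <- enum 'I_n] = #|[set i | p (f i)]%SET|.
Proof.
by rewrite cardsE cardE [in RHS]/enum_mem size_filter -enumT count_map.
Qed.

Lemma spacings_enum (n : nat) (f : 'I_n -> R) :
  spacings [seq f i | i <- enum 'I_n] =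
  [seq increment 1 (sort <=%R [seq f i | i <- enum 'I_n]) i
     | i : 'I_n.+1 <- enum 'I_n.+1].
Proof.
rewrite /spacings size_map size_enum_ord.
rewrite -[1%N]addn0 iotaDl -val_enum_ord -!map_comp.
by apply: eq_map => i.
Qed.

End increments.

(** * The law of a uniform sample and its invariance under translation *)

Section finite_union.
Context (d : measure_display) (T : measurableType d) (R : realType).

Lemma measure_bigcup_pred (mu : {measure set T -> \bar R}) (I : finType)
    (D : pred I) (F : I -> set T) :
  (forall i, D i -> measurable (F i)) -> trivIset [set` D] F ->
  mu (\bigcup_(i in [set` D]) F i) = (\sum_(i | D i) mu (F i))%E.
Proof.
move=> mF tF; rewrite measure_fin_bigcup//.
have -> : [set` D] = [set` [seq i <- index_enum I | D i]].
  by apply/seteqP; split=> i /=; rewrite mem_filter mem_index_enum andbT.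
by rewrite -fsbig_seq ?big_filter// filter_uniq// index_enum_uniq.
Qed.

End finite_union.

Section uniform_boxes.
Context (d : measure_display) (T : measurableType d) (R : realType)
  (P : probability T R).

(** Stated on [measurableTypeR], the type that carries [lebesgue_measure], so
that its pushforward is again a measure there. *)
Definition translate (a r : measurableTypeR R) : measurableTypeR R := r - a.

Lemma measurable_translate a : measurable_fun setT (translate a).
Proof. exact: measurable_funB. Qed.

HB.instance Definition _ a := isMeasurableFun.Build _ _ _ _ (translate a)
  (measurable_translate a).

Lemma lebesgue_translate (a : R) (A : set R) : measurable A ->
  lebesgue_measure (translate a @^-1` A) = lebesgue_measure A.
Proof.
move=> mA; apply/esym.
apply: (lebesgue_measure_unique
  (mu := pushforward lebesgue_measure (translate a))) => //.
move=> _ [[l r] _ <-].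
transitivity (lebesgue_measure `](l + a), (r + a)]%classic).
  rewrite !lebesgue_measure_itv/= !lte_fin ltrD2r -!EFinB.
  by rewrite (_ : r + a - (l + a) = r - l)//; ring.
congr lebesgue_measure.
by apply/seteqP; split => y /=; rewrite !in_itv/= /translate; lra.
Qed.

(** Both [A] and its translate by [a] lie in the unit interval, where the uniform
density is [1]. *)
Lemma uniform_shift (X : {RV P >-> R}) (a c : R) (A : set R) :
  uniform01 X -> 0 <= a -> a + c <= 1 -> measurable A -> A `<=` `]0, c[ ->
  P [set w | A (X w - a)] = lebesgue_measure A.
Proof.
move=> uX a0 ac mA Ac.
have mS : measurable (translate a @^-1` A).
  by rewrite -[X in measurable X]setTI; exact: measurable_translate.
rewrite -[LHS]/(distribution P X (translate a @^-1` A)) uX//.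
rewrite -(lebesgue_translate a mA) /uniform_prob.
rewrite (eq_integral (cst 1%E)) => [|r]; first by rewrite integral_cst// mul1e.
rewrite inE/= => /Ac/=; rewrite in_itv/= => /andP[r0 rc].
by rewrite /translate in r0 rc; rewrite /uniform_pdf ifT ?subr0 ?invr1//; lra.
Qed.

Variables (n : nat) (U : 'I_n -> {RV P >-> R}).
Hypotheses (indep : mutually_independent U) (unif : forall i, uniform01 (U i)).

Lemma prob_box (a : 'I_n -> R) (c : R) (A : 'I_n -> set R) :
  (forall i, 0 <= a i) -> (forall i, a i + c <= 1) ->
  (forall i, measurable (A i)) -> (forall i, A i `<=` `]0, c[) ->
  P [set w | forall i, A i (U i w - a i)] = (\prod_i lebesgue_measure (A i))%E.
Proof.
move=> a0 ac mA Ac.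
have mS i : measurable (translate (a i) @^-1` A i).
  rewrite -[X in measurable X]setTI; apply: measurable_translate => //.
  exact: mA.
have := indep (J := finset.setT) (A := fun i => translate (a i) @^-1` A i).
rewrite (_ : \bigcap_(i in _) _ = [set w | forall i, A i (U i w - a i)]).
  move=> ->.
    apply: eq_big => i; first by rewrite inE.
    by move=> _; rewrite -(uniform_shift (unif i) (a0 i) (ac i) (mA i) (Ac i)).
  move=> i _; exact: mS.
by apply/seteqP; split=> w H i; [apply: H; rewrite /= inE|move=> _; exact: H].
Qed.

End uniform_boxes.

Section shift_invariance.
Context (d : measure_display) (T : measurableType d) (R : realType)
  (P : probability T R) (n : nat) (U : 'I_n -> {RV P >-> R}).

(** The sample moved by [- a]; tuples are used for their product sigma-algebra. *)
Definition shifted (a : 'I_n -> R) (w : T) : n.-tuple R :=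
  [tuple U i w - a i | i < n].

Lemma measurable_shifted a : measurable_fun setT (shifted a).
Proof.
apply/measurable_fun_tnthP => i.
rewrite (_ : _ \o _ = fun w => U i w - a i); last first.
  by apply/funext => w; rewrite /= tnth_mktuple.
exact: measurable_funB.
Qed.

HB.instance Definition _ a := isMeasurableFun.Build _ _ _ _ (shifted a)
  (measurable_shifted a).

Definition box (A : 'I_n -> set R) :
  set (n.-tuple R) := [set t | forall i, A i (tnth t i)].

Lemma measurable_box A : (forall i, measurable (A i)) -> measurable (box A).
Proof.
move=> mA; rewrite (_ : box A =
  \bigcap_(i in [set: 'I_n]) (@tnth _ _ ^~ i @^-1` A i)).
  apply: fin_bigcap_measurable => // i _; rewrite -[X in measurable X]setTI.
  exact: measurable_tnth.
by apply/seteqP; split=> t tA i; [move=> _; exact: tA|exact: tA].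
Qed.

Definition boxes := [set box A | A in [set A | forall i, measurable (A i)]].

Lemma measurable_tuple_boxes :
  @measurable _ (n.-tuple R) = <<s boxes >>.
Proof.
apply/seteqP; split; last first.
  apply: smallest_sub; first exact: sigma_algebra_measurable.
  by move=> _ [A mA <-]; exact: measurable_box.
apply: smallest_sub; first exact: smallest_sigma_algebra.
rewrite -bigcup_seq; apply: bigcup_sub => i _ _ [A mA <-].
apply: sub_sigma_algebra; exists (fun j => if j == i then A else setT).
  by move=> j; case: ifP.
by rewrite setTI; apply/seteqP; split => [t /(_ i)|t tA j];
  rewrite ?eqxx//; case: eqP => // ->.
Qed.

Hypotheses (indep : mutually_independent U) (unif : forall i, uniform01 (U i)).

(** The two finite measures given by the two sides agree on boxes by [prob_box],
and boxes form a generating pi-system. *)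
Lemma prob_shift (a : 'I_n -> R) (c : R) (B : set (n.-tuple R)) :
  (forall i, 0 <= a i) -> c <= 1 -> (forall i, a i + c <= 1) -> measurable B ->
  P (shifted a @^-1` (B `&` box (fun=> `]0, c[%classic))) =
  P (shifted (cst 0) @^-1` (B `&` box (fun=> `]0, c[%classic))).
Proof.
move=> a0 c0 ac mB.
have mD : measurable (box (fun=> `]0, c[%classic)) by exact: measurable_box.
apply: (measure_unique boxes (fun=> setT) _ _ _ _
  (mrestr (distribution P (shifted a)) mD)
  (mrestr (distribution P (shifted (cst 0))) mD)) => //.
- exact: measurable_tuple_boxes.
- move=> _ _ [A mA <-] [A' mA' <-]; exists (fun i => A i `&` A' i).
    by move=> i; exact: measurableI.
  apply/seteqP; split=> t; first by move=> H; split=> i; case: (H i).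
  by move=> [H H'] i; split.
- by move=> _; exists (fun=> setT) => //; apply/seteqP; split.
- by rewrite bigcup_const//; exists 0%N.
- move=> _ [A mA <-].
  have boxE (b : 'I_n -> R) :
      (forall i, 0 <= b i) -> (forall i, b i + c <= 1) ->
      P (shifted b @^-1` (box A `&` box (fun=> `]0, c[%classic))) =
      (\prod_i lebesgue_measure (A i `&` `]0%R, c[%classic))%E.
    move=> b0 bc; rewrite -(prob_box indep unif (a := b) (c := c))//.
    - congr (P _); apply/seteqP; split=> [w [/= H H'] i|w H].
        by have := conj (H i) (H' i); rewrite tnth_mktuple.
      by split=> i; case: (H i); rewrite /= tnth_mktuple.
    - by move=> i; apply: measurableI => //; exact: mA.
  apply: etrans (boxE a a0 ac) (esym (boxE (cst 0) _ _)) => // i.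
  by rewrite add0r.
- move=> _; apply: le_lt_trans (ltry 1); apply: probability_le1.
  exact: measurableI.
Qed.
End shift_invariance.

(** * Splitting an event according to the sorting permutation *)

Section sorting_events.
Context (d : measure_display) (T : measurableType d) (R : realType) (n : nat).
Implicit Types X : 'I_n -> T -> R.

Lemma measurable_sorted (r : rel R) X :
  (forall f g : T -> R, measurable_fun setT f -> measurable_fun setT g ->
     measurable [set w | r (f w) (g w)]) ->
  (forall i, measurable_fun setT (X i)) ->
  measurable [set w | sorted r [seq X i w | i <- enum 'I_n]].
Proof.
move=> mr mX.
rewrite (_ : mkset _ = \bigcap_(i in [set i : 'I_n * 'I_n | i.2 = i.1.+1 :> nat])
    [set w | r (X i.1 w) (X i.2 w)]).
  by apply: fin_bigcap_measurable => // -[i j] _; exact: mr.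
apply/seteqP; split=> w /=.
  move=> /sortedP-/(_ 0) H [i j]/= ij.
  have := H i; rewrite size_map size_enum_ord -ij ltn_ord => /(_ isT).
  by rewrite !(nth_enum_map (X ^~ w)).
move=> H; apply/(sortedP 0) => i; rewrite size_map size_enum_ord => iS.
have := H (Ordinal (ltnW iS), Ordinal iS) erefl.
by rewrite /= -!(nth_enum_map (X ^~ w)).
Qed.

Lemma measurable_le_set (f g : T -> R) :
  measurable_fun setT f -> measurable_fun setT g ->
  measurable [set w | f w <= g w].
Proof.
move=> mf mg; have := measurable_fun_ler mf mg.
by move=> /(_ measurableT [set true])/=; rewrite setTI; apply.
Qed.

Lemma measurable_lt_set (f g : T -> R) :
  measurable_fun setT f -> measurable_fun setT g ->
  measurable [set w | f w < g w].
Proof.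
move=> mf mg; have := measurable_fun_ltr mf mg.
by move=> /(_ measurableT [set true])/=; rewrite setTI; apply.
Qed.

(** On the measurable set where a given permutation sorts the family, an order
statistic is one of its members. *)
Lemma measurable_nth_sort X (j : nat) :
  (forall i, measurable_fun setT (X i)) ->
  measurable_fun setT
    (fun w => nth 0 (sort <=%R [seq X i w | i <- enum 'I_n]) j).
Proof.
move=> mX _ A mA; rewrite setTI.
rewrite (_ : _ @^-1` A = \bigcup_(s in [set: 'S_n])
    ([set w | sorted <=%R [seq X (s i) w | i <- enum 'I_n]] `&`
     [set w | A (nth 0 [seq X (s i) w | i <- enum 'I_n] j)])).
  apply: fin_bigcup_measurable => [|s _]; first exact: finite_finset.
  apply: measurableI.
    by apply: measurable_sorted => // *; exact: measurable_le_set.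
  have [jn|nj] := ltnP j n.
    rewrite (_ : mkset _ = X (s (Ordinal jn)) @^-1` A).
      by rewrite -[X in measurable X]setTI; exact: mX.
    apply/seteqP; split=> w /=;
      by rewrite (nth_enum_map (fun i => X (s i) w) (Ordinal jn)).
  rewrite (_ : mkset _ = (cst 0 : T -> R) @^-1` A).
    by rewrite -[X in measurable X]setTI; exact: measurable_cst.
  by apply/seteqP; split=> w /=; rewrite nth_default// size_map size_enum_ord.
apply/seteqP; split=> w /=.
  have [s es] := sort_perm (X ^~ w); rewrite es => Aw.
  by exists s => //; split=> //=; rewrite -es; apply/sort_sorted/le_total.
by move=> [s _ [/= ss]]; rewrite (@sorted_perm_eq _ _ (X ^~ w) s).
Qed.

Definition perm_event X (E : set (seq R)) (s : 'S_n) : set T :=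
  [set w | E [seq X (s i) w | i <- enum 'I_n]].

Lemma sort_event X (E : set (seq R)) :
  (forall s, size s = n -> E s -> sorted <%R s) ->
  [set w | E (sort <=%R [seq X i w | i <- enum 'I_n])] =
  \bigcup_(s in [set: 'S_n]) perm_event X E s.
Proof.
move=> Esorted; apply/seteqP; split=> w /=.
  by have [s es] := sort_perm (X ^~ w); rewrite es => Ew; exists s.
move=> [s _ Ew]; rewrite (@sorted_perm_eq _ _ (X ^~ w) s)//.
apply/(sub_sorted (@ltW _ R)); apply: Esorted Ew.
by rewrite size_map size_enum_ord.
Qed.

Lemma measurable_sort_event X (E : set (seq R)) :
  (forall s, size s = n -> E s -> sorted <%R s) ->
  (forall s, measurable (perm_event X E s)) ->
  measurable [set w | E (sort <=%R [seq X i w | i <- enum 'I_n])].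
Proof.
move=> Es mE; rewrite sort_event//; apply: fin_bigcup_measurable => //.
exact: finite_finset.
Qed.

(** Strict monotonicity under [E] forces the absence of ties, so that exactly one
permutation contributes for each outcome. *)
Lemma prob_sort_event (P : probability T R) X (E : set (seq R)) :
  (forall s, size s = n -> E s -> sorted <%R s) ->
  (forall s, measurable (perm_event X E s)) ->
  P [set w | E (sort <=%R [seq X i w | i <- enum 'I_n])] =
  (\sum_(s : 'S_n) P (perm_event X E s))%E.
Proof.
move=> Es mE; rewrite sort_event//.
rewrite -(@measure_bigcup_pred _ _ _ P _ xpredT (perm_event X E))//.
  by congr (P _); apply: eq_bigcupl; split.
move=> s t _ _ [w [Ew Et]]; apply: (@sorted_perm_inj _ _ (X ^~ w)).
- by apply: Es Ew; rewrite size_map size_enum_ord.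
- by apply: Es Et; rewrite size_map size_enum_ord.
Qed.

End sorting_events.

(** * Ties have probability zero *)

Section no_ties.
Context (d : measure_display) (T : measurableType d) (R : realType)
  (P : probability T R) (n : nat) (U : 'I_n -> {RV P >-> R}).
Hypotheses (indep : mutually_independent U) (unif : forall i, uniform01 (U i)).

Definition in_cube (c : R) : set T := [set w | forall i, 0 < U i w < c].

Lemma measurable_in_cube c : measurable (in_cube c).
Proof.
rewrite (_ : in_cube c = \bigcap_(i in [set: 'I_n]) (U i @^-1` `]0, c[)).
  apply: fin_bigcap_measurable => // i _; rewrite -[X in measurable X]setTI.
  exact: measurable_funPT.
apply/seteqP; split=> w H i; first by move=> _; rewrite /= in_itv/=; exact: H.
by have := H i I; rewrite /= in_itv.
Qed.

Lemma prob_in_cube (c : R) : 0 <= c <= 1 -> P (in_cube c) = (c ^+ n)%:E.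
Proof.
move=> /andP[c0 c1].
rewrite (_ : in_cube c = [set w | forall i, `]0, c[%classic (U i w - 0)]).
  rewrite (prob_box (a := fun=> 0) (c := c) (A := fun=> `]0, c[%classic)
    indep unif)//; [|by move=> _; rewrite add0r|by move=> _].
  rewrite lebesgue_measure_itv/= lte_fin -EFinB subr0.
  rewrite (_ : (if _ then _ else _) = c%:E); last first.
    by move: c0; rewrite le_eqVlt => /predU1P[<-|->//]; rewrite ltxx.
  by rewrite prodEFin prodr_const card_ord.
by apply/seteqP; split=> w H i; have := H i; rewrite /= in_itv/= subr0.
Qed.

(** Restricted to the open unit cube, so that [prob_box] applies to the cells. *)
Definition tie (i j : 'I_n) : set T := in_cube 1 `&` [set w | U i w = U j w].

Lemma measurable_tie i j : measurable (tie i j).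
Proof.
apply: measurableI; first exact: measurable_in_cube.
have mi := measurable_funPT (U i); have mj := measurable_funPT (U j).
rewrite (_ : mkset _ = [set w | U i w <= U j w] `&` [set w | U j w <= U i w]).
  by apply: measurableI; exact: measurable_le_set.
apply/seteqP; split=> w /=; first by move=> ->.
by move=> [ij ji]; apply/eqP; rewrite eq_le ij ji.
Qed.

(** Two tied points fall into the same one of [N.+1] cells of width [N.+1^-1];
independence gives each cell probability at most [N.+1^-2]. *)
Lemma prob_tie_le (i j : 'I_n) (N : nat) : i != j ->
  (P (tie i j) <= N.+1%:R^-1%:E)%E.
Proof.
move=> ij.
pose cell (m : nat) : set R := `[m%:R / N.+1%:R, m.+1%:R / N.+1%:R[ `&` `]0, 1[.
(* The coordinates other than [i] and [j] are only confined to ]0, 1[, which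
   costs a factor [1]. *)
pose A m (l : 'I_n) := if (l == i) || (l == j) then cell m else `]0, 1[%classic.
have mI m : measurable (cell m) by exact: measurableI.
have mA m l : measurable (A m l) by rewrite /A; case: ifP.
have A01 m l : A m l `<=` `]0, 1[ by rewrite /A; case: ifP => // _ r [].
have lI m : (lebesgue_measure (cell m) <= N.+1%:R^-1%:E)%E.
  apply: (@le_trans _ _ (lebesgue_measure
      `[(m%:R / N.+1%:R), (m.+1%:R / N.+1%:R)[%classic : \bar R)).
    by apply: le_measure; rewrite ?inE//; [exact: mI|exact: subIsetl].
  rewrite lebesgue_measure_itv/= lte_fin -EFinB; case: ifP => _ //.
  by rewrite lee_fin -mulrBl -natrB// subSnn mul1r.
pose C m := [set w | forall l, A m l (U l w)].
have mC m : measurable (C m).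
  rewrite (_ : C m = \bigcap_(l in [set: 'I_n]) (U l @^-1` A m l)).
    apply: fin_bigcap_measurable => // l _; rewrite -[X in measurable X]setTI.
    exact: measurable_funPT.
  by apply/seteqP; split=> w H l => [_|]; exact: H.
have PC m : (P (C m) <= (N.+1%:R^-1 ^+ 2)%:E)%E.
  rewrite (_ : C m = [set w | forall l, A m l (U l w - 0)]); last first.
    by apply/seteqP; split=> w H l; have := H l; rewrite subr0.
  rewrite (prob_box (a := fun=> 0) (c := 1) indep unif)//.
  rewrite (bigD1 i)//= (bigD1 j)//= 1?eq_sym// big1 => [|l /andP[li lj]].
    rewrite mule1 /A !eqxx orbT/= expr2 EFinM.
    by apply: lee_pmul.
  rewrite /A (negbTE li) (negbTE lj)/= lebesgue_measure_itv/= lte_fin ltr01.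
  by rewrite -EFinB subr0.
have sub : tie i j `<=` \big[setU/set0]_(m < N.+1) C m.
  move=> w [/= U01 Uij].
  have /andP[u0 u1] := U01 i.
  have v0 : 0 <= U i w * N.+1%:R by rewrite mulr_ge0// ltW.
  have /andP[t0 t1] := truncn_itv v0.
  (* The cell of a point [u] of ]0, 1[ has index [truncn (u * N.+1)]. *)
  have tN : (Num.truncn (U i w * N.+1%:R) < N.+1)%N.
    by rewrite -(ltr_nat R) (le_lt_trans t0)// gtr_pMl.
  rewrite -bigcup_mkord; exists (Num.truncn (U i w * N.+1%:R)) => // l /=.
  have IU : cell (Num.truncn (U i w * N.+1%:R)) (U i w).
    by split; rewrite /= in_itv/= ?u0// ler_pdivrMr// t0 ltr_pdivlMr.
  rewrite /A; case: ifP => [/orP[]/eqP-> //|_]; first by rewrite -Uij.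
  by rewrite /= in_itv/=; exact: U01.
apply: (le_trans (@content_subadditive _ _ _ P _ _ _ _ _ sub)) => //.
  exact: measurable_tie.
apply: (@le_trans _ _ (\sum_(m < N.+1) (N.+1%:R^-1 ^+ 2)%:E)%E).
  by apply: lee_sum => m _; exact: PC.
rewrite sumEFin sumr_const card_ord lee_fin expr2 -mulrnAr -[_^-1 *+ _]mulr_natr.
by rewrite mulVf ?mulr1.
Qed.

Lemma prob_tie (i j : 'I_n) : i != j -> P (tie i j) = 0%E.
Proof.
move=> ij.
have fP : P (tie i j) \is a fin_num.
  by rewrite fin_num_measure//; exact: measurable_tie.
apply/eqP; rewrite eq_le measure_ge0 andbT -(fineK fP) lee_fin leNgt.
apply/negP => /ltr_add_invr[N]; rewrite add0r => /lt_geF.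
by rewrite -lee_fin fineK// prob_tie_le.
Qed.

Lemma negligible_ties :
  P.-negligible (\bigcup_(ij in [set ij : 'I_n * 'I_n | ij.1 != ij.2])
    tie ij.1 ij.2).
Proof.
rewrite (bigcup_pred (fun ij : 'I_n * 'I_n => ij.1 != ij.2)).
elim/big_ind: _ => [|A B|[i j]]; first exact: negligible_set0.
  exact: negligibleU.
by move=> ij; apply/negligibleP; [exact: measurable_tie|exact: prob_tie].
Qed.

(** Sorting a point of the cube gives a strictly increasing sequence unless two
coordinates are tied. *)
Lemma prob_increasing_cube (c : R) : 0 <= c <= 1 ->
  P [set w | sorted <%R (sort <=%R [seq U i w | i <- enum 'I_n]) /\ in_cube c w]
    = (c ^+ n)%:E.
Proof.
move=> c01; rewrite -(prob_in_cube c01).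
have mC := measurable_in_cube c.
pose S := [set w | sorted <%R (sort <=%R [seq U i w | i <- enum 'I_n])].
have mS : measurable S.
  apply: (measurable_sort_event (X := fun i => U i)
    (E := [set s | sorted <%R s])) => // s.
  apply: measurable_sorted; first exact: measurable_lt_set.
  by move=> i; exact: measurable_funPT.
rewrite -[LHS]/(P (S `&` in_cube c)) setIC (measureDI P mC mS).
rewrite [X in (X + _)%E]measure_negligible ?add0e//; first exact: measurableD.
apply: negligibleS negligible_ties => w [Cw /= nS].
apply: contrapT => noties; apply: nS; rewrite /S/= sort_lt_sorted.
rewrite map_inj_uniq ?enum_uniq// => i j Uij.
have [//|ij] := eqVneq i j.
case: noties; exists (i, j) => //=; split=> // l.
by have /andP[-> /lt_le_trans->//] := Cw l; case/andP: c01.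
Qed.

End no_ties.

(** * The probability that all spacings exceed given thresholds *)

Section spacing_volume.
Context (d : measure_display) (T : measurableType d) (R : realType)
  (P : probability T R) (n : nat) (U : 'I_n -> {RV P >-> R}).
Hypotheses (indep : mutually_independent U) (unif : forall i, uniform01 (U i)).

Definition gaps_above (delta : 'I_n.+1 -> R) : set (seq R) :=
  [set s | forall i : 'I_n.+1, delta i < increment 1 s i].

Lemma gaps_above_sorted (delta : 'I_n.+1 -> R) (s : seq R) :
  (forall i, 0 <= delta i) -> size s = n -> gaps_above delta s ->
  sorted <%R s.
Proof.
move=> d0 sn ds; suff [] : sorted <%R s /\ all (fun v => 0 < v < 1) s by [].
apply/(increments_gt0P sn ltr01) => i.
by apply: le_lt_trans (ds i); exact: d0.
Qed.

(** The rank of the sample point [l] under [s] is [s^-1 l], counted from [0]; the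
increments to its left are those of index at most that rank. *)
Definition gap_offset (delta : 'I_n.+1 -> R) (s : 'S_n) (l : 'I_n) : R :=
  \sum_(j : 'I_n.+1 | (j <= (s^-1)%g l)%N) delta j.

Definition chain (s : 'S_n) : set (n.-tuple R) :=
  [set t | sorted <%R [seq tnth t (s i) | i <- enum 'I_n]].

Lemma measurable_chain s : measurable (chain s).
Proof.
apply: (measurable_sorted (X := fun i (t : n.-tuple R) => tnth t (s i))).
  exact: measurable_lt_set.
by move=> i; exact: measurable_tnth.
Qed.

(** After the translation the thresholds are [0], and positive increments mean an
increasing sequence in [`]0, c[]. *)
Lemma perm_event_gaps_above (delta : 'I_n.+1 -> R) (s : 'S_n) :
  0 < 1 - \sum_i delta i ->
  perm_event (fun i => U i) (gaps_above delta) s =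
  shifted U (gap_offset delta s) @^-1`
    (chain s `&` box (fun=> `]0, (1 - \sum_i delta i)[%classic)).
Proof.
move=> c0; set c := 1 - _ in c0 *.
apply/seteqP.
have E w : perm_event (fun i => U i) (gaps_above delta) s w <->
    (shifted U (gap_offset delta s) @^-1`
      (chain s `&` box (fun=> `]0, c[%classic))) w.
  set v := [seq tnth (shifted U (gap_offset delta s) w) (s i) | i <- enum 'I_n].
  have vE : v = [seq U (s m) w - \sum_(j : 'I_n.+1 | (j <= m)%N) delta j
      | m <- enum 'I_n].
    by apply: eq_map => m; rewrite tnth_mktuple /gap_offset permK.
  have sv : size v = n by rewrite size_map size_enum_ord.
  apply: (@iff_trans _ (forall i : 'I_n.+1, 0 < increment c v i)).
    by split=> H i; have := H i;
      rewrite vE (increment_shift (fun m => U (s m) w)) subr_gt0.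
  rewrite (increments_gt0P sv c0).
  split=> -[sortv cubev]; split=> //.
    move=> l; have /allP/(_ (v`_((s^-1)%g l))) := cubev.
    rewrite mem_nth ?sv// => /(_ isT).
    by rewrite /v nth_enum_map permKV /= in_itv.
  apply/allP => _ /mapP[m _ ->].
  by have := cubev (s m); rewrite /= in_itv.
by split=> w; rewrite E.
Qed.

Lemma perm_event_shift0 (s : 'S_n) (c : R) :
  shifted U (cst 0) @^-1` (chain s `&` box (fun=> `]0, c[%classic)) =
  perm_event (fun i => U i)
    [set r | sorted <%R r /\ all (fun v => 0 < v < c) r] s.
Proof.
have E w : [seq tnth (shifted U (cst 0) w) (s i) | i <- enum 'I_n] =
    [seq U (s i) w | i <- enum 'I_n].
  by apply: eq_map => m; rewrite tnth_mktuple subr0.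
apply/seteqP; split=> w [/= sw cw]; split; rewrite /chain /= ?E//.
- by rewrite -E.
- apply/allP => _ /mapP[m _ ->].
  by have := cw (s m); rewrite tnth_mktuple/= subr0 in_itv.
- move=> l; have /allP/(_ (U l w)) := cw; rewrite tnth_mktuple/= subr0 in_itv/=.
  by apply; apply/mapP; exists ((s^-1)%g l); rewrite ?mem_enum ?permKV.
Qed.

(** Each piece is translated by its own [gap_offset]; the translated pieces
reassemble into the points without ties of the cube of side [c]. *)
Lemma prob_gaps_above (delta : 'I_n.+1 -> R) :
  (forall i, 0 <= delta i) -> 0 < 1 - \sum_i delta i ->
  P [set w | gaps_above delta (sort <=%R [seq U i w | i <- enum 'I_n])] =
  ((1 - \sum_i delta i) ^+ n)%:E.
Proof.
move=> d0 c0; set c := 1 - _ in c0 *.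
have mB s : measurable (chain s `&` box (fun=> `]0, c[%classic)).
  by apply: measurableI; [exact: measurable_chain|exact: measurable_box].
have c1 : c <= 1 by rewrite /c lerBlDr lerDl sumr_ge0.
have mshift a s : measurable
    (shifted U a @^-1` (chain s `&` box (fun=> `]0, c[%classic))).
  by rewrite -[X in measurable X]setTI; exact: measurable_shifted.
rewrite (@prob_sort_event _ _ _ _ P (fun i => U i) (gaps_above delta)); first last.
- by move=> s; rewrite perm_event_gaps_above.
- by move=> s sn; exact: gaps_above_sorted.
pose E' := [set r : seq R | sorted <%R r /\ all (fun v => 0 < v < c) r].
transitivity (\sum_(s : 'S_n) P (perm_event (fun i => U i) E' s))%E.
  apply: eq_bigr => s _; rewrite perm_event_gaps_above// -/c.
  rewrite -perm_event_shift0 (prob_shift indep unif)//.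
  - by move=> l; exact: sumr_ge0.
  - move=> l; rewrite /c addrCA gerDl subr_le0 /gap_offset.
    rewrite [leRHS](bigID (fun j : 'I_n.+1 => (j <= (s^-1)%g l)%N))/=.
    by rewrite lerDl sumr_ge0.
  - exact: measurable_chain.
rewrite -(@prob_sort_event _ _ _ _ P _ E'); first last.
- by move=> s; rewrite -perm_event_shift0.
- by move=> s _ [].
rewrite -(prob_increasing_cube indep unif (c := c)) ?c1 ?ltW//.
congr (P _); apply/seteqP; split=> w [/= sw cw]; split=> //=.
  move: cw; rewrite all_sort => cw i.
  by apply: (allP cw); apply/mapP; exists i; rewrite ?mem_enum.
by rewrite all_sort; apply/allP => _ /mapP[i _ ->]; exact: cw.
Qed.

End spacing_volume.

(** * The random set of spacings exceeding [x] *)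

Section exceeding_spacings.
Context (d : measure_display) (T : measurableType d) (R : realType)
  (P : probability T R) (n : nat) (U : 'I_n -> {RV P >-> R}).
Hypotheses (indep : mutually_independent U) (unif : forall i, uniform01 (U i)).
Hypothesis n_ge1 : (1 <= n)%N.
Variable x : R.
Hypothesis x_gt0 : 0 < x.

Definition gap (i : nat) (w : T) : R :=
  increment 1 (sort <=%R [seq U i w | i <- enum 'I_n]) i.

Lemma measurable_gap i : measurable_fun setT (gap i).
Proof.
have mU j := measurable_funPT (U j).
have mpt j : measurable_fun setT (fun w =>
    nth 0 (0 :: rcons (sort <=%R [seq U i w | i <- enum 'I_n]) 1) j).
  case: j => [|j] /=; first exact: measurable_cst.
  rewrite (_ : (fun _ => _) = fun w => if (j < n)%N then
     nth 0 (sort <=%R [seq U i w | i <- enum 'I_n]) j else (j == n)%:R).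
    by case: (j < n)%N; [exact: measurable_nth_sort|exact: measurable_cst].
  apply/funext => w; rewrite nth_rcons size_sort size_map size_enum_ord.
  by case: ifP => // _; case: ifP.
exact: measurable_funB.
Qed.

Lemma sum_increment (s : seq R) : size s = n ->
  \sum_(i < n.+1) increment 1 s i = 1.
Proof.
move=> sn; rewrite -(big_mkord xpredT (increment 1 s)).
by rewrite telescope_sumr//= nth_rcons sn ltnn eqxx subr0.
Qed.

(** An event of probability one that excludes the outcomes with ties or with
points outside the unit interval, where the spacings misbehave. *)
Definition positive_gaps : set T := [set w | forall i : 'I_n.+1, 0 < gap i w].

Definition exceeding (w : T) : {set 'I_n.+1} :=
  [set i : 'I_n.+1 | x < gap i w]%SET.

(** The thresholds are [x] on [J] and [0] elsewhere.  When they add up to at least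
[1], the event contradicts [sum_increment]. *)
Lemma prob_subset_exceeding (J : {set 'I_n.+1}) :
  P (positive_gaps `&` [set w | J \subset exceeding w]) =
  (Num.max (1 - #|J|%:R * x) 0 ^+ n)%:E.
Proof.
pose delta (i : 'I_n.+1) := if i \in J then x else 0.
have sum_delta : \sum_i delta i = #|J|%:R * x.
  by rewrite -big_mkcond/= sumr_const mulr_natl.
have -> : positive_gaps `&` [set w | J \subset exceeding w] =
    [set w | gaps_above delta (sort <=%R [seq U i w | i <- enum 'I_n])].
  apply/seteqP; split=> [w [w0 /= /fintype.subsetP Jw] i|w wd].
    by rewrite /delta; case: ifP => [/Jw|_]; [rewrite inE|exact: w0].
  split=> [i|/=].
    by apply: le_lt_trans (wd i); rewrite /delta; case: ifP => // _; exact: ltW.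
  by apply/fintype.subsetP => i iJ; have := wd i; rewrite /delta iJ inE.
have [c0|c0] := ltP 0 (1 - #|J|%:R * x).
  rewrite prob_gaps_above// ?sum_delta//.
  by move=> i; rewrite /delta; case: ifP => // _; exact: ltW.
rewrite (_ : mkset _ = set0) ?measure0; last first.
  apply/seteqP; split=> w //= wd.
  move: c0; rewrite subr_le0 leNgt => /negP; apply.
  rewrite -sum_delta.
  rewrite -[ltRHS](@sum_increment (sort <=%R [seq U i w | i <- enum 'I_n])).
    apply: ltr_sum => //.
    by apply/hasP; exists ord0; rewrite ?mem_index_enum.
  by rewrite size_sort size_map size_enum_ord.
by rewrite expr0n gtn_eqF.
Qed.

Lemma prob_positive_gaps : P positive_gaps = 1%E.
Proof.
have := prob_subset_exceeding finset.set0.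
rewrite cards0 mul0r subr0 (max_idPl ler01) expr1n => <-; congr (P _).
apply/seteqP; split=> w; last by case.
by move=> w0; split=> //=; rewrite finset.sub0set.
Qed.

Lemma measurable_positive_gaps : measurable positive_gaps.
Proof.
rewrite (_ : positive_gaps =
    \bigcap_(i in [set: 'I_n.+1]) [set w | 0 < gap i w]).
  apply: fin_bigcap_measurable => // i _.
  by apply: measurable_lt_set => //; exact: measurable_gap.
by apply/seteqP; split=> w H i => [_|]; exact: H.
Qed.

Lemma measurable_exceeding (A : {set 'I_n.+1}) :
  measurable [set w | exceeding w = A].
Proof.
rewrite (_ : mkset _ = \bigcap_(i in [set: 'I_n.+1])
    (if i \in A then [set w | x < gap i w] else [set w | gap i w <= x])).
  apply: fin_bigcap_measurable => // i _; case: ifP => _.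
    by apply: measurable_lt_set => //; exact: measurable_gap.
  by apply: measurable_le_set => //; exact: measurable_gap.
apply/seteqP; split=> [w <- i _|w H].
  by rewrite inE; case: ifP => //= /negbT; rewrite -leNgt.
apply/setP => i; rewrite inE; have := H i I.
by case: ifP => _ //=; rewrite leNgt => /negbTE.
Qed.

Definition exact_prob (A : {set 'I_n.+1}) : R :=
  fine (P (positive_gaps `&` [set w | exceeding w = A])).

Lemma exceeding_event (Q : pred {set 'I_n.+1}) :
  [set w | Q (exceeding w)] =
  \bigcup_(A in [set` Q]) [set w | exceeding w = A].
Proof.
by apply/seteqP; split=> w /=; [exists (exceeding w)|move=> [A QA ->]].
Qed.

Lemma measurable_exceeding_event (Q : pred {set 'I_n.+1}) :
  measurable [set w | Q (exceeding w)].
Proof.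
rewrite exceeding_event; apply: fin_bigcup_measurable => [|A _].
  exact: finite_finset.
exact: measurable_exceeding.
Qed.

Lemma prob_exceeding_event (Q : pred {set 'I_n.+1}) :
  P (positive_gaps `&` [set w | Q (exceeding w)]) =
  (\sum_(A | Q A) exact_prob A)%:E.
Proof.
have mA A : measurable (positive_gaps `&` [set w | exceeding w = A]).
  apply: measurableI; first exact: measurable_positive_gaps.
  exact: measurable_exceeding.
rewrite exceeding_event setI_bigcupr.
rewrite (@measure_bigcup_pred _ _ _ P _ Q
  (fun A => positive_gaps `&` [set w | exceeding w = A]))//.
  rewrite -sumEFin; apply: eq_bigr => A _.
  by rewrite /exact_prob fineK// fin_num_measure.
by move=> A B _ _ [w [[_ /= <-] [_ /= <-]]].
Qed.

(** [waring] for the random set [exceeding], restricted to [positive_gaps]. *)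
Lemma prob_card_exceeding (m : nat) :
  P [set w | #|exceeding w| == m] =
  (\sum_(0 <= j < n.+2) (-1) ^+ (j + m) * 'C(j, m)%:R *
     Num.max (1 - j%:R * x) 0 ^+ n * 'C(n.+1, j)%:R)%:E.
Proof.
have mE := measurable_exceeding_event (fun A => #|A| == m).
have mP := measurable_positive_gaps.
have PC : P (~` positive_gaps) = 0%E.
  by rewrite probability_setC// prob_positive_gaps subee.
transitivity (P (positive_gaps `&` [set w | #|exceeding w| == m])).
  rewrite (measureDI P mE mP) setIC [X in (X + _)%E]measure_negligible ?add0e//.
    exact: measurableD.
  by exists (~` positive_gaps); split=> //; exact: measurableC.
rewrite (prob_exceeding_event (fun A => #|A| == m)) waring; congr EFin.
rewrite (eq_bigr (fun J : {set 'I_n.+1} =>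
  (-1) ^+ (#|J| + m) * 'C(#|J|, m)%:R * Num.max (1 - #|J|%:R * x) 0 ^+ n)).
  rewrite (eq_bigl (fun J : {set 'I_n.+1} => J \subset finset.setT)); last first.
    by move=> J; rewrite finset.subsetT.
  rewrite (sum_powerset_card finset.setT (fun j => (-1) ^+ (j + m)
    * 'C(j, m)%:R * Num.max (1 - j%:R * x) 0 ^+ n)).
  by rewrite cardsT card_ord.
move=> J _; congr (_ * _); apply: EFin_inj.
by rewrite -(prob_exceeding_event (fun A => J \subset A)) prob_subset_exceeding.
Qed.

End exceeding_spacings.

Theorem theorem1p2 (R : realType) (d : measure_display) (T : measurableType d)
    (P : probability T R) (n : nat) (U : 'I_n -> {RV P >-> R})
    (n_ge1 : (1 <= n)%N)
    (U_indep : mutually_independent U)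
    (U_unif : forall i, uniform01 (U i))
    (k : nat) (k_le : (k <= n.+1)%N) (x : R) (x_gt0 : 0 < x) (x_lt1 : x < 1) :
  P [set w | ordered_spacing (fun i => U i w) k <= x
             < ordered_spacing (fun i => U i w) k.+1] =
  ((-1) ^+ k * 'C(n.+1, k)%:R *
   \sum_(0 <= r < k.+1)
     (-1) ^+ r * 'C(k, r)%:R *
     (Num.max (1 - (n%:R - r%:R + 1) * x) 0) ^+ n)%:E.
Proof.
transitivity (P [set w | #|exceeding U x w| == (n.+1 - k)%N]).
  congr (P _); apply/seteqP.
  have E w : (ordered_spacing (fun i => U i w) k <= x
       < ordered_spacing (fun i => U i w) k.+1) =
      (#|exceeding U x w| == (n.+1 - k)%N).
    have sz : size (spacings [seq U i w | i <- enum 'I_n]) = n.+1.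
      by rewrite spacings_enum size_map size_enum_ord.
    rewrite order_stat_count ?sz//; last by rewrite ltW.
    rewrite count_le_gt sz spacings_enum.
    rewrite (count_enum (fun i : 'I_n.+1 => gap U i w)).
    (* [order_stat_count] counts the spacings at most [x], [exceeding] the
       others. *)
    have := max_card (mem (exceeding U x w)); rewrite card_ord /exceeding.
    move: #|_| => e en; apply/eqP/eqP; lia.
  by split=> w /=; rewrite E.
rewrite (prob_card_exceeding U_indep U_unif n_ge1 x_gt0).
rewrite (reverse_waring (fun j => Num.max (1 - j%:R * x) 0 ^+ n) k_le).
congr EFin; congr (_ * _); apply: eq_big_nat => r /andP[_ rk].
rewrite natrB; last by rewrite (leq_trans _ k_le).
by rewrite -natr1 addrAC.
Qed.
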